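(* Fix a real number $w>2$. For every $\varepsilon>0$ there exists $n_0$ (depending on $w$ and $\varepsilon$) such that for every $n>n_0$ and every symmetric equilibrium $S$ of the game $G(n;w)$, $$2\le \frac{C_{n,w}(S)}{SC(n,w)}\le 2+\varepsilon .$$ In particular, as $n\to\infty$ the ratio between the social cost of any symmetric equilibrium and the optimal social cost tends to $2$.
   Context: The game $G(n;w)$ ($n\ge 2$ an integer, $w>1$ real): there are $n$ agents and discrete time steps $t=1,2,3,\dots$. Initially all agents are outside an empty first-come-first-served queue. At each time step: (1) each agent still outside decides, simultaneously with the others and possibly using independent randomization, whether to enter the queue; (2) all agents who decided to enter are appended to the end of the queue in uniformly random order; (3) if the queue is nonempty, the first agent in it is processed and leaves, and each remaining agent in the queue incurs cost $w$; (4) each agent outside the queue incurs cost $1$. Each agent minimizes his expected total cost (possibly $+\infty$). The state at the start of a step is $(m,k)$, where $m\ge1$ agents are still outside and $k\ge 0$ agents are in the queue, $m+k\le n$. An anonymous stationary strategy specifies, for each state $(m,k)$, a probability $q_{m,k}\in[0,1]$ of entering, used whenever that state occurs. A profile is symmetric if all agents use the same strategy. A symmetric equilibrium is a symmetric profile of anonymous stationary strategies in which no agent can strictly decrease his expected cost by unilaterally deviating to another anonymous stationary strategy. $c_{n,w}(S)$ is the expected cost of each agent under the symmetric profile $S$, and $C_{n,w}(S)=n\cdot c_{n,w}(S)$ is the social cost. $SC(n,w)=n(n-1)/2$ is the optimal (unrestricted) social cost, attained when agents enter one after the other. *)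

(* Defs.v *)
From HB Require Import structures.
From mathcomp Require Import all_boot all_order all_algebra perm.
From mathcomp Require Import all_classical all_reals all_analysis.
Set Implicit Arguments.
Unset Strict Implicit.
Unset Printing Implicit Defensive.
Import Order.TTheory GRing.Theory Num.Theory.
Import numFieldNormedType.Exports.
Local Open Scope ring_scope.

(* [q m k] is the probability of entering in state (m, k): m agents outside
   and k agents in the queue. *)
Definition strategy (R : realType) := nat -> nat -> R.

Definition is_strategy (R : realType) (n : nat) (q : strategy R) : Prop :=
  forall m k : nat, (0 < m)%N -> (m + k <= n)%N -> 0 <= q m k <= 1.

Definition profile (R : realType) (n : nat) := 'I_n -> strategy R.

(* A configuration at the start of a time step: the set of agents outside,
   and the queue, whose head is processed first. An agent occurring in neither
   has been processed. *)
Definition config (n : nat) : Type := ({set 'I_n} * seq 'I_n)%type.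

Definition init (n : nat) : config n := ([set: 'I_n], [::]).

(* One time step from [c], in which the agents of [E] enter in the order [r]. *)
Definition next (n : nat) (c : config n) (E : {set 'I_n}) (r : seq 'I_n) :
  config n := (c.1 :\: E, behead (c.2 ++ r)).

Definition step_cost (R : realType) (n : nat) (w : R) (c : config n)
    (E : {set 'I_n}) (r : seq 'I_n) (i : 'I_n) : R :=
  if i \in (next c E r).1 then 1
  else if i \in (next c E r).2 then w
  else 0.

Definition entry_prob (R : realType) (n : nat) (p : profile R n)
    (c : config n) (E : {set 'I_n}) : R :=
  \prod_(j in c.1) (if j \in E then p j #|c.1| (size c.2)
                    else 1 - p j #|c.1| (size c.2)).

(* Expectation of [F E r] when the set [E] of entering agents results from
   independent decisions and [r] is a uniformly random ordering of [E]. *)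
Definition step_mean (R : realType) (n : nat) (p : profile R n) (c : config n)
    (F : {set 'I_n} -> seq 'I_n -> R) : R :=
  \sum_(E : {set 'I_n} | E \subset c.1)
    entry_prob p c E *
    ((\sum_(r <- permutations (enum E)) F E r) / (#|E|)`!%:R).

(* Expected cost incurred by agent [i] during the next [T] steps. *)
Fixpoint horizon_cost (R : realType) (n : nat) (w : R) (p : profile R n)
    (T : nat) (c : config n) (i : 'I_n) : R :=
  if T is T'.+1 then
    step_mean p c (fun E r =>
      step_cost w c E r i + horizon_cost w p T' (next c E r) i)
  else 0.

(* Costs are nonnegative, so by monotone convergence the expected total cost
   is the limit in [0, +oo] of the expected costs over finite horizons. *)
Definition agent_cost (R : realType) (n : nat) (w : R) (p : profile R n)
    (i : 'I_n) : \bar R :=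
  limn (fun T : nat => (horizon_cost w p T (init n) i)%:E).

Definition symmetric_profile (R : realType) (n : nat) (q : strategy R) :
  profile R n := fun=> q.

Definition deviate (R : realType) (n : nat) (p : profile R n) (i : 'I_n)
    (q' : strategy R) : profile R n :=
  fun j => if j == i then q' else p j.

Definition symmetric_equilibrium (R : realType) (n : nat) (w : R)
    (q : strategy R) : Prop :=
  is_strategy n q /\
  forall (i : 'I_n) (q' : strategy R), is_strategy n q' ->
    (agent_cost w (symmetric_profile q) i
     <= agent_cost w (deviate (symmetric_profile q) i q') i)%E.

(* Equal to n times the cost of any single agent: see [social_costE]. *)
Definition social_cost (R : realType) (n : nat) (w : R) (q : strategy R) :
  \bar R := (\sum_(i < n) agent_cost w (symmetric_profile q) i)%E.

(* In the optimum the agents enter one after the other, and the cost of the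
   i-th agent to enter is i - 1. *)
Definition opt_social_cost (R : realType) (n : nat) : R :=
  n%:R * (n%:R - 1) / 2.

Definition cost_ratio (R : realType) (n : nat) (w : R) (q : strategy R) :
  \bar R := (social_cost n w q / (opt_social_cost R n)%:E)%E.

Definition relabel (n : nat) (s : 'S_n) (c : config n) : config n :=
  (s @: c.1, map s c.2).

Lemma next_relabel (n : nat) (s : 'S_n) (c : config n) (E : {set 'I_n})
    (r : seq 'I_n) :
  next (relabel s c) (s @: E) (map s r) = relabel s (next c E r).
Proof.
rewrite /next /relabel /= -map_cat behead_map; congr (_, _).
have sI := @perm_inj _ s; apply/setP => x; rewrite -(permKV s x).
by rewrite inE !mem_imset // inE.
Qed.

Lemma permutations_imset (n : nat) (s : 'S_n) (E : {set 'I_n}) :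
  perm_eq (permutations (enum (s @: E))) (map (map s) (permutations (enum E))).
Proof.
apply: uniq_perm.
- exact: permutations_uniq.
- by rewrite map_inj_uniq ?permutations_uniq //; exact/inj_map/perm_inj.
have EE : perm_eq (enum (s @: E)) (map s (enum E)).
  apply: uniq_perm; rewrite ?enum_uniq //.
    by rewrite map_inj_uniq ?enum_uniq //; exact: perm_inj.
  move=> x; rewrite mem_enum; apply/imsetP/mapP => -[y yE ->]; exists y => //.
    by rewrite mem_enum.
  by rewrite -mem_enum.
move=> t; rewrite mem_permutations (permPr EE).
apply/idP/mapP => [tE|[u + ->]].
  exists (map s^-1%g t); last by rewrite -map_comp map_id_in // => x _ /=; rewrite permKV.
  rewrite mem_permutations.
  have -> : enum E = map s^-1%g (map s (enum E)).
    by rewrite -map_comp map_id_in // => x _ /=; rewrite permK.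
  exact: perm_map.
by rewrite mem_permutations => uE; exact: perm_map.
Qed.

Lemma horizon_cost_relabel (R : realType) (n : nat) (w : R) (q : strategy R)
    (s : 'S_n) (T : nat) (c : config n) (i : 'I_n) :
  horizon_cost w (symmetric_profile q) T (relabel s c) (s i) =
  horizon_cost w (symmetric_profile q) T c i.
Proof.
elim: T c => [//|T IH] c /=; rewrite /step_mean.
have sI := @perm_inj _ s.
rewrite (reindex_inj (imset_inj sI)) /=.
apply: eq_big => [E|E _].
  apply/idP/idP => sE; last exact: imsetS.
  apply/fintype.subsetP => x xE.
  by rewrite -(mem_imset _ _ sI); exact: (fintype.subsetP sE _ (imset_f s xE)).
congr (_ * _).
  rewrite /entry_prob /= size_map card_imset // big_imset /=; last exact: in2W.
  by apply: eq_bigr => j _; rewrite mem_imset.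
congr (_ / _); last by rewrite card_imset.
rewrite (perm_big _ (permutations_imset s E)) big_map; apply: eq_bigr => r _.
by rewrite next_relabel IH /step_cost next_relabel /= mem_imset // mem_map.
Qed.

Lemma social_costE (R : realType) (n : nat) (w : R) (q : strategy R)
    (i : 'I_n) :
  social_cost n w q = (n%:R%:E * agent_cost w (symmetric_profile q) i)%E.
Proof.
have cE (j : 'I_n) : agent_cost w (symmetric_profile q) j
          = agent_cost w (symmetric_profile q) i.
  rewrite /agent_cost; congr (limn _); apply/funext => T; congr (_%:E).
  rewrite -(horizon_cost_relabel w q (tperm j i)) tpermL; congr horizon_cost.
  rewrite /init /relabel /=; congr (_, _).
  apply/setP => x; rewrite inE; apply/imsetP; exists (tperm j i x); rewrite ?inE //.
  by rewrite tpermK.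
rewrite /social_cost (eq_bigr (fun=> agent_cost w (symmetric_profile q) i)).
  by rewrite big_const_ord iter_addr_0 mule_natl.
by move=> j _; exact: cE.
Qed.

(* Main.v *)
(* In a state (m, k), an agent who stays outside until everybody else is gone
   pays at least m - 1 + k, and one who enters pays
   w (k + (m - 1) q / 2) on average, q = q(m, k). At every state that is reached
   with positive probability the equilibrium cost V is at most the cost of
   entering. If q < 1, staying is then no dearer than entering, hence no dearer
   than V; if q = 1, entering costs at least m - 1 + k because w > 2. By induction
   on the horizon V >= m - 1 + k, which gives the lower bound n - 1 at (n, 0).
   At (m, 0) with m >= 2 it gives w (m - 1) q / 2 >= m - 1, i.e. q >= 2 / w, so
   the probability of an idle step is at most (1 - 2 / w)^(m - 1). An agent who
   deviates to waiting for all the others therefore expects at most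
   n - 1 + (w / 2)^2 in total, and this bounds the equilibrium cost. *)
Require Import Defs.
From mathcomp Require Import all_boot all_order all_algebra perm.
From mathcomp Require Import all_classical all_reals all_analysis.
From mathcomp Require Import ring lra zify.
Import Order.TTheory GRing.Theory Num.Theory.
Import numFieldNormedType.Exports.
Local Open Scope classical_set_scope.
Local Open Scope ring_scope.
Set Implicit Arguments.
Unset Strict Implicit.
Unset Printing Implicit Defensive.

(** * Means over a binomial number of entrants *)

Section binomial_mean.
Context {R : realType}.
Implicit Types (N : nat) (x : R) (f g : nat -> R).

Definition bmean N x f : R := \sum_(b < N.+1) binomial_pmf N x b * f b.

Lemma bmean_ext N x f g :
  (forall b, (b <= N)%N -> f b = g b) -> bmean N x f = bmean N x g.
Proof. by move=> fg; apply: eq_bigr => b _; rewrite fg // -ltnS. Qed.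

Lemma bmeanD N x f g : bmean N x (fun b => f b + g b) = bmean N x f + bmean N x g.
Proof. by rewrite -big_split; apply: eq_bigr => b _; rewrite mulrDr. Qed.

Lemma bmeanZ N x a f : bmean N x (fun b => a * f b) = a * bmean N x f.
Proof. by rewrite mulr_sumr; apply: eq_bigr => b _; rewrite mulrCA. Qed.

Lemma bmean_cst N x a : bmean N x (fun=> a) = a.
Proof.
rewrite /bmean -mulr_suml -[RHS]mul1r; congr (_ * _).
have := exprDn (1 - x) x N; rewrite subrK expr1n => ->.
by apply: eq_bigr => b _; rewrite /binomial_pmf mulrC.
Qed.

(** The absorption identity (N + 1) C(N, b) = (b + 1) C(N + 1, b + 1) reduces this to the total mass
    of the binomial law with one trial fewer. *)
Lemma bmean_id N x : bmean N x (fun b => b%:R) = N%:R * x.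
Proof.
case: N => [|N]; first by rewrite /bmean big_ord1 mulr0 mul0r.
rewrite /bmean big_ord_recl mulr0 add0r -[RHS](bmean_cst N x) [RHS]/bmean.
apply: eq_bigr => b _; rewrite /binomial_pmf /= /bump leq0n add1n subSS exprS.
have /(congr1 (fun k => k%:R : R)) := mul_bin_diag N.+1 b; rewrite !natrM /= => e.
rewrite -[_ *+ 'C(N.+1, _)]mulr_natr -[_ *+ 'C(N, _)]mulr_natr; move: e.
move: (_%:R) (_%:R) (_%:R) (_%:R) (x ^+ b) (_ ^+ (N - _)) => u v s t y z e.
by transitivity (x * y * z * (v * u)); [ring | rewrite -e; ring].
Qed.

(** Outcomes of weight zero are exempted because the bounds used later hold only at states reached
    with positive probability. *)
Lemma bmean_supp_le N x f g : 0 <= x <= 1 ->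
  (forall b, (b <= N)%N -> 0 < binomial_pmf N x b -> f b <= g b) ->
  bmean N x f <= bmean N x g.
Proof.
move=> x01 fg; apply: ler_sum => b _.
have := binomial_pmf_ge0 N b x01; rewrite le_eqVlt => /predU1P[<-|b0].
  by rewrite !mul0r.
by rewrite ler_pM2l // fg // -ltnS.
Qed.

Lemma bmean_le N x f g : 0 <= x <= 1 ->
  (forall b, (b <= N)%N -> f b <= g b) -> bmean N x f <= bmean N x g.
Proof. by move=> x01 fg; apply: bmean_supp_le => // b bN _; exact: fg. Qed.

(** Carries a strict gain at one outcome one time step backwards. *)
Lemma bmean_gap N x f g b0 (d : R) : 0 <= x <= 1 -> (b0 <= N)%N ->
  (forall b, (b <= N)%N -> f b <= g b) -> f b0 + d <= g b0 ->
  bmean N x f + binomial_pmf N x b0 * d <= bmean N x g.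
Proof.
move=> x01 b0N fg dg; rewrite /bmean.
rewrite (bigD1 (inord b0)) //= [leRHS](bigD1 (inord b0)) //= inordK // addrAC.
apply: lerD; first by rewrite -mulrDr ler_wpM2l // binomial_pmf_ge0.
by apply: ler_sum => b _; rewrite ler_wpM2l ?binomial_pmf_ge0 // fg // -ltnS.
Qed.

Lemma bmean_at0 N x : bmean N x (fun b => (b == 0%N)%:R) = (1 - x) ^+ N.
Proof.
rewrite /bmean big_ord_recl big1 ?addr0 => [|b _]; last by rewrite mulr0.
by rewrite /binomial_pmf /= bin0 subn0 expr0 mul1r mulr1n mulr1.
Qed.

Lemma binomial_pmf1_gt0 N b : (b <= N)%N -> 0 < binomial_pmf N (1 : R) b -> b = N.
Proof.
move=> bN; rewrite /binomial_pmf /unstable.onem subrr expr0n subn_eq0.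
by case: leqP => Nb; rewrite ?mulr0 ?mul0rn ?ltxx // => _; lia.
Qed.

(** Group the subsets by cardinality: C(#|A|, b) of them have b elements, all with the same
    weight. *)
Lemma subset_bmean (T : finType) (A : {set T}) x f :
  \sum_(E : {set T} | E \subset A)
     (\prod_(j in A) (if j \in E then x else 1 - x)) * f #|E|
  = bmean #|A| x f.
Proof.
pose P (E : {set T}) := E \subset A.
rewrite (partition_big (fun E : {set T} => inord #|E| : 'I_#|A|.+1) predT) //=.
apply: eq_bigr => b _.
rewrite (eq_big (fun E => E \in [set E : {set T} | E \subset A & #|E| == b])
                (fun=> x ^+ b * (1 - x) ^+ (#|A| - b) * f b)); last 2 first.
- move=> E; rewrite inE; case EA: (E \subset A) => //=.
  by rewrite -val_eqE /= inordK // ltnS subset_leq_card.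
- move=> E /andP[EA /eqP bE]; have Eb : #|E| = b :> nat.
    by rewrite -bE inordK // ltnS subset_leq_card.
  rewrite -Eb; congr (_ * _).
  rewrite (big_setID E) (finset.setIidPr EA) /=; congr (_ * _).
    by rewrite -prodr_const; apply: eq_bigr => j ->.
  rewrite -(finset.setIidPr EA) -cardsD -prodr_const.
  by rewrite (finset.setIidPr EA); apply: eq_bigr => j; rewrite inE => /andP[/negbTE->].
rewrite sumr_const cards_draws /binomial_pmf.
by rewrite mulrnAl.
Qed.

End binomial_mean.

(** * Uniform position of an entrant in a random order *)

Section positions.
Context {R : realType} (n : nat).
Implicit Types (E : {set 'I_n}) (i : 'I_n).

(** The transposition of i and i' preserves E, hence permutes its orderings. *)
Lemma sum_index_tperm (f : nat -> R) E i i' : i \in E -> i' \in E ->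
  \sum_(r <- permutations (enum E)) f (index i r)
  = \sum_(r <- permutations (enum E)) f (index i' r).
Proof.
move=> iE i'E; pose s := tperm i i'.
have sE : s @: E = E.
  apply/eqP; rewrite eqEcard card_imset ?leqnn ?andbT; last exact: perm_inj.
  apply/fintype.subsetP => _ /imsetP[x xE ->]; rewrite /s.
  by case: tpermP => // ->.
rewrite -{2}sE (perm_big _ (permutations_imset s E)) big_map.
by apply: eq_bigr => r _; rewrite -(index_map (@perm_inj _ s)) /s tpermL.
Qed.

(** Sum the left side over all members of E, which all contribute equally. In a fixed ordering their
    indices run once through 0, ..., #|E| - 1, so the double sum is #|E|! times the sum of f. *)
Lemma mean_index (f : nat -> R) E i : i \in E ->
  (\sum_(r <- permutations (enum E)) f (index i r)) / (#|E|)`!%:R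
  = (\sum_(j < #|E|) f j) / #|E|%:R.
Proof.
move=> iE; have E0 : #|E|%:R != 0 :> R.
  by rewrite pnatr_eq0 -lt0n card_gt0; apply/set0Pn; exists i.
apply: (mulIf E0); rewrite divfK // mulrAC.
suff -> : (\sum_(r <- permutations (enum E)) f (index i r)) * #|E|%:R
          = (\sum_(j < #|E|) f j) * (#|E|)`!%:R.
  by rewrite mulfK // pnatr_eq0 -lt0n fact_gt0.
rewrite mulr_natr -sumr_const.
under eq_bigr => i' i'E do rewrite (sum_index_tperm f iE i'E).
rewrite exchange_big /= big_seq.
under eq_bigr => r; first rewrite mem_permutations => rE.
  rewrite -big_enum -(perm_big _ rE) (big_nth i) big_mkord (perm_size rE) -cardE.
  under eq_bigr => j _.
    rewrite index_uniq ?(perm_uniq rE) ?enum_uniq ?(perm_size rE) -?cardE //; over.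
  over.
by rewrite -big_seq big_const_seq count_predT size_permutations ?enum_uniq //
  -cardE iter_addr_0 mulr_natr.
Qed.

End positions.

(** * One time step seen by a single agent *)

Section step_mean.
Context {R : realType} (n : nat).
Implicit Types (p : profile R n) (c : config n) (E : {set 'I_n}) (i : 'I_n).

Lemma mean_perm_cst E (F : seq 'I_n -> R) (v : R) :
  (forall r, r \in permutations (enum E) -> F r = v) ->
  (\sum_(r <- permutations (enum E)) F r) / (#|E|)`!%:R = v.
Proof.
move=> Fv; rewrite big_seq (eq_bigr (fun=> v)) // -big_seq big_const_seq count_predT.
rewrite size_permutations ?enum_uniq // -cardE iter_addr_0 -[v *+ _]mulr_natr mulfK //.
Qed.

Lemma step_mean_cst p c (F : {set 'I_n} -> seq 'I_n -> R) (x v : R) :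
  (forall j, j \in c.1 -> p j #|c.1| (size c.2) = x) ->
  (forall E r, E \subset c.1 -> r \in permutations (enum E) -> F E r = v) ->
  step_mean p c F = v.
Proof.
move=> px Fv; rewrite -[RHS](bmean_cst #|c.1| x) -subset_bmean.
apply: eq_bigr => E EA; rewrite (mean_perm_cst (v := v)) => [|r]; last exact: Fv.
by congr (_ * _); apply: eq_bigr => j jA; rewrite px.
Qed.

(** Condition on the decision of i. Both f and g take the number of other entrants, which is
    binomial with #|c.1|.-1 trials; hence [#|E|.-1] when i itself enters. *)
Lemma step_mean_split p c i (F : {set 'I_n} -> seq 'I_n -> R) (x : R)
    (f g : nat -> R) :
  i \in c.1 ->
  (forall j, j \in c.1 -> j != i -> p j #|c.1| (size c.2) = x) ->
  (forall E, E \subset c.1 -> i \in E ->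
     (\sum_(r <- permutations (enum E)) F E r) / (#|E|)`!%:R = f #|E|.-1) ->
  (forall E, E \subset c.1 -> i \notin E ->
     (\sum_(r <- permutations (enum E)) F E r) / (#|E|)`!%:R = g #|E|) ->
  step_mean p c F = p i #|c.1| (size c.2) * bmean #|c.1|.-1 x f
                    + (1 - p i #|c.1| (size c.2)) * bmean #|c.1|.-1 x g.
Proof.
move=> ic px Ff Fg; rewrite /step_mean (bigID (fun E : {set 'I_n} => i \in E)) /=.
have cA : #|c.1|.-1 = #|c.1 :\ i| by rewrite (cardsD1 i c.1) ic.
have prodE E : \prod_(j in c.1 :\ i) (if j \in i |: E then p j #|c.1| (size c.2)
                    else 1 - p j #|c.1| (size c.2))
               = \prod_(j in c.1 :\ i) (if j \in E then x else 1 - x).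
  apply: eq_bigr => j; rewrite !inE => /andP[ji jc].
  by rewrite (negbTE ji) /= px.
rewrite cA -!subset_bmean !mulr_sumr; congr (_ + _).
  rewrite (reindex_onto (fun E => i |: E) (fun E => E :\ i)) /=; last first.
    by move=> E /andP[_ iE]; rewrite finset.setD1K.
  apply: eq_big => [E|E /andP[/andP[Ec _] /eqP EE]].
    rewrite setU11 andbT finset.subUset finset.sub1set ic subsetD1 /=.
    case: (boolP (i \in E)) => iE /=; last by rewrite finset.setU1K // eqxx.
    rewrite andbF; apply/negbTE/negP => /andP[_ /eqP EE].
    by move: iE; rewrite -EE !inE eqxx.
  have iE : i \notin E by rewrite -EE !inE eqxx.
  rewrite (Ff _ Ec (setU11 _ _)) cardsU1 iE /=.
  rewrite /entry_prob (big_setD1 _ ic) /= setU11.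
  by rewrite prodE mulrA.
apply: eq_big => [E|E /andP[Ec iE]]; first by rewrite subsetD1.
rewrite (Fg _ Ec iE) /entry_prob (big_setD1 _ ic) /= (negbTE iE) -mulrA.
congr (_ * (_ * _)); rewrite -prodE; apply: eq_bigr => j.
by rewrite !inE => /andP[/negbTE->].
Qed.

End step_mean.

(** * Reduction of configurations to states (m, k) *)

Section reduction.
Context {R : realType} (w : R).
Implicit Types (q : strategy R) (m k T : nat).

(* With [b] other entrants the agent lands at each of the positions k, ..., k + b
   with equal probability; [minn _ T] cuts the waiting time at the horizon. *)
Definition entry_cost q T m k : R :=
  bmean m.-1 (q m k)
    (fun b => (\sum_(j < b.+1) w * (minn (k + j) T)%:R) / b.+1%:R).

(* Expected cost over [T] steps of an outside agent who plays [q'] against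
   opponents who play [q]. *)
Fixpoint state_cost q q' T m k : R :=
  if T is T'.+1 then
    q' m k * entry_cost q T m k
    + (1 - q' m k)
      * (1 + bmean m.-1 (q m k) (fun b => state_cost q q' T' (m - b) (k + b).-1))
  else 0.

(** Here t is the queue after the entries. Its head is processed free of charge, and having i at
    most once in t rules out that it occurs again behind the head. *)
Lemma behead_cost n (i : 'I_n) (t : seq 'I_n) T : (count_mem i t <= 1)%N ->
  (if i \in behead t then w else 0)
  + (if i \in behead t then w * (minn (index i (behead t)) T)%:R else 0)
  = if i \in t then w * (minn (index i t) T.+1)%:R else 0.
Proof.
case: t => [_|x t] /=; first by rewrite addr0.
rewrite inE [x == i]eq_sym; case: (eqVneq i x) => [_|_] /=.
  by rewrite addSn ltnS leqn0 => /eqP/count_memPn/negbTE ->; rewrite min0n mulr0 addr0.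
by case: ifP => _ _; rewrite ?addr0 // minnSS -natr1 mulrDr mulr1 addrC.
Qed.

(** Later entrants line up behind i, so its cost depends only on its present position. *)
Lemma queue_cost n (p : profile R n) (q : strategy R) i T (c : config n) :
  (forall j, j != i -> p j = q) -> i \notin c.1 -> (count_mem i c.2 <= 1)%N ->
  horizon_cost w p T c i
  = if i \in c.2 then w * (minn (index i c.2) T)%:R else 0.
Proof.
move=> px; elim: T c => [|T IH] c iA i1 /=; first by rewrite minn0 mulr0 if_same.
apply: (@step_mean_cst _ _ _ _ _ (q #|c.1| (size c.2))) => [j jA|E r EA rE].
  by rewrite px //; apply: contraNneq iA => <-.
have iE : i \notin E by apply: contra iA; exact: (fintype.subsetP EA).
have ir : i \notin r.
  by move: rE; rewrite mem_permutations => /perm_mem ->; rewrite mem_enum.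
have it : (count_mem i (c.2 ++ r) <= 1)%N.
  by rewrite count_cat (count_memPn ir) addn0.
have iN : i \notin (Defs.next c E r).1 by rewrite inE (negbTE iA) andbF.
rewrite /step_cost (negbTE iN) IH // ?behead_cost //.
  by rewrite mem_cat (negbTE ir) orbF index_cat; case: (i \in c.2).
by apply: leq_trans it; rewrite /=; case: (c.2 ++ r) => //= x t; exact: leq_addl.
Qed.

(** Entering fixes the remaining cost through the position obtained; staying leads to a
    configuration whose cost depends only on its two sizes. In an idle step the queue length stays
    0, in accordance with the truncated predecessor in [(k + b).-1]. *)
Lemma horizon_costE n q q' i T (c : config n) :
  i \in c.1 -> i \notin c.2 ->
  horizon_cost w (deviate (symmetric_profile q) i q') T c i
  = state_cost q q' T #|c.1| (size c.2).
Proof.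
have pi : deviate (symmetric_profile q) i q' i = q' by rewrite /deviate eqxx.
have pj j : j != i -> deviate (symmetric_profile q) i q' j = q.
  by rewrite /deviate => /negbTE ->.
elim: T c => [//|T IH] c ic ik; rewrite [LHS]/=.
rewrite (@step_mean_split _ _ _ _ i _ (q #|c.1| (size c.2))
  (fun b => (\sum_(j < b.+1) w * (minn (size c.2 + j) T.+1)%:R) / b.+1%:R)
  (fun b => 1 + state_cost q q' T (#|c.1| - b) (size c.2 + b).-1)) //.
- by rewrite pi bmeanD bmean_cst.
- by move=> j _ /pj ->.
- move=> E Ec iE; have E0 : (0 < #|E|)%N by rewrite card_gt0; apply/set0Pn; exists i.
  rewrite (prednK E0) -(mean_index (fun j => w * (minn (size c.2 + j) T.+1)%:R) iE).
  congr (_ / _); rewrite big_seq [RHS]big_seq; apply: eq_bigr => r.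
  rewrite mem_permutations => rE.
  have ir : i \in r by rewrite (perm_mem rE) mem_enum.
  have iN : i \notin (Defs.next c E r).1 by rewrite inE iE.
  have it : count_mem i (c.2 ++ r) = 1%N.
    rewrite count_cat (count_memPn ik) count_uniq_mem ?ir //.
    by rewrite (perm_uniq rE) enum_uniq.
  rewrite /step_cost (negbTE iN) (queue_cost _ pj) //.
    by rewrite behead_cost ?it // mem_cat ir orbT index_cat (negbTE ik).
  apply: (@leq_trans (count_mem i (c.2 ++ r))); last by rewrite it.
  by rewrite /=; case: (c.2 ++ r) => //= x t; exact: leq_addl.
- move=> E Ec iE; apply: mean_perm_cst => r rE.
  have ir : i \notin r.
    by move: rE; rewrite mem_permutations => /perm_mem ->; rewrite mem_enum.
  have iN : i \in (Defs.next c E r).1 by rewrite inE iE.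
  rewrite /step_cost iN IH //=; last first.
    by apply/negP => /mem_behead; rewrite mem_cat (negbTE ik) (negbTE ir).
  rewrite size_behead size_cat cardsD (finset.setIidPr Ec).
  by move: rE; rewrite mem_permutations => /perm_size ->; rewrite -cardE.
Qed.

End reduction.

(** * The cost of entering, in closed form *)

Section entry_cost.
Context {R : realType} (w : R).
Implicit Types (q : strategy R) (m k T : nat).

(** The cost of entering with no horizon: on average half of the other entrants end up ahead. *)
Definition full_entry_cost q m k : R := w * (k%:R + m.-1%:R * q m k / 2).

Lemma mean_position k b :
  (\sum_(j < b.+1) w * (k + j)%:R) / b.+1%:R = w * (k%:R + b%:R / 2) :> R.
Proof.
have b0 : b.+1%:R != 0 :> R by rewrite pnatr_eq0.
apply: (mulIf b0); rewrite divfK // -mulr_sumr -mulrA; congr (_ * _).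
elim: b b0 => [|b IH] _; first by rewrite big_ord1 addn0; field.
by rewrite big_ord_recr /= IH ?pnatr_eq0 // natrD -!natr1; field.
Qed.

Lemma full_entry_costE q m k :
  bmean m.-1 (q m k) (fun b => (\sum_(j < b.+1) w * (k + j)%:R) / b.+1%:R)
  = full_entry_cost q m k.
Proof.
under bmean_ext => b _ do rewrite mean_position.
rewrite (bmeanZ _ _ w) bmeanD bmean_cst.
rewrite (@bmean_ext _ _ _ _ (fun b => 2^-1 * b%:R)) => [|b _]; last exact: mulrC.
by rewrite bmeanZ bmean_id /full_entry_cost [2^-1 * _]mulrC.
Qed.

Lemma entry_costE q m k T : (m.-1 + k <= T)%N ->
  entry_cost w q T m k = full_entry_cost q m k.
Proof.
move=> mkT; rewrite -full_entry_costE; apply: bmean_ext => b bm.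
congr (_ / _); apply: eq_bigr => j _; congr (_ * _%:R).
by have := ltn_ord j; lia.
Qed.

End entry_cost.

(** * Nonnegativity and monotonicity in the horizon *)

Section state_cost.
Context {R : realType} (w : R) (w0 : 0 <= w) (n : nat).
Implicit Types (q : strategy R) (m k T : nat).

Lemma entry_cost_homo q m k T T' : 0 <= q m k <= 1 -> (T <= T')%N ->
  entry_cost w q T m k <= entry_cost w q T' m k.
Proof.
move=> q01 TT; apply: bmean_le => // b _; rewrite ler_wpM2r // ler_sum // => j _.
by rewrite ler_wpM2l // ler_nat; lia.
Qed.

Lemma entry_cost_le q m k T : 0 <= q m k <= 1 ->
  entry_cost w q T m k <= full_entry_cost w q m k.
Proof.
move=> q01; rewrite -full_entry_costE.
apply: bmean_le => // b _; rewrite ler_wpM2r // ler_sum // => j _.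
by rewrite ler_wpM2l // ler_nat; lia.
Qed.

Lemma entry_cost_ge0 q m k T : 0 <= q m k <= 1 -> 0 <= entry_cost w q T m k.
Proof.
move=> q01; apply: sumr_ge0 => b _; rewrite mulr_ge0 ?binomial_pmf_ge0 //.
by rewrite divr_ge0 // sumr_ge0 // => j _; rewrite mulr_ge0.
Qed.

Variables (q q' : strategy R).
Hypotheses (qS : is_strategy n q) (q'S : is_strategy n q').

Lemma state_cost_ge0 T m k : (0 < m)%N -> (m + k <= n)%N ->
  0 <= state_cost w q q' T m k.
Proof.
elim: T m k => [//|T IH] m k m0 mkn /=.
have /andP[q0 q1] := q'S m0 mkn; have q01 := qS m0 mkn.
rewrite addr_ge0 // mulr_ge0 ?subr_ge0 ?entry_cost_ge0 ?addr_ge0 //.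
apply: sumr_ge0 => b _; rewrite mulr_ge0 ?binomial_pmf_ge0 // IH //.
  by have := ltn_ord b; lia.
by have := ltn_ord b; lia.
Qed.

Lemma state_costS T m k : (0 < m)%N -> (m + k <= n)%N ->
  state_cost w q q' T m k <= state_cost w q q' T.+1 m k.
Proof.
elim: T m k => [|T IH] m k m0 mkn; first exact: state_cost_ge0.
have /andP[q0 q1] := q'S m0 mkn; have q01 := qS m0 mkn.
rewrite [leLHS]/= [leRHS]/=; apply: lerD; apply: ler_wpM2l; rewrite ?subr_ge0 //.
  by apply: entry_cost_homo.
rewrite lerD2l; apply: bmean_le => // b bm; apply: IH; lia.
Qed.

Lemma state_cost_homo T T' m k : (0 < m)%N -> (m + k <= n)%N -> (T <= T')%N ->
  state_cost w q q' T m k <= state_cost w q q' T' m k.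
Proof.
move=> m0 mkn /subnK <-; elim: (T' - T)%N => [//|d IH].
by rewrite addSn; apply: le_trans IH _; exact: state_costS.
Qed.

End state_cost.

(** * Equilibrium bounds on the cost of a state *)

Section equilibrium.
Context {R : realType} (w : R) (w2 : 2 < w) (n : nat) (n0 : (0 < n)%N).
Variables (q : strategy R) (qS : is_strategy n q).

(** The states that an agent still outside meets with positive probability when all play [q]: he
    stays out, whence [q m k < 1], and b of the others enter. *)
Inductive reach : nat -> nat -> Prop :=
| reach_init : reach n 0
| reach_step m k b : reach m k -> (b <= m.-1)%N -> q m k < 1 ->
    0 < binomial_pmf m.-1 (q m k) b -> reach (m - b) (k + b).-1.

Lemma reach_valid m k : reach m k -> (0 < m)%N /\ (m + k <= n)%N.
Proof. by elim=> [|{}m {}k b _ IH bm _ _]; lia. Qed.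

(** The equilibrium condition without extended reals: total costs are suprema over the horizons, so
    any finite bound on the cost of a deviation also bounds that of [q]. *)
Hypothesis best : forall (q' : strategy R) (M : R), is_strategy n q' ->
  (forall T, state_cost w q q' T n 0 <= M) ->
  forall T, state_cost w q q T n 0 <= M.

Let w0 : 0 <= w. Proof. by move: w2; lra. Qed.
Let V T m k := state_cost w q q T m k.
Let ent m k := full_entry_cost w q m k.

(** Compare with entering at once. In particular the equilibrium cost is finite. *)
Lemma init_cost_le T : V T n 0 <= ent n 0.
Proof.
apply: (@best (fun _ _ => 1)) => [m k _ _|]; first by rewrite ler01 lexx.
have q01 : 0 <= q n 0 <= 1 by apply: qS => //; rewrite addn0.
case=> [|T'] /=; last by rewrite mul1r subrr mul0r addr0 entry_cost_le.
by apply: le_trans (entry_cost_le w0 0 q01); exact: entry_cost_ge0.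
Qed.

(** The deviation would cost at most [sup A - d] at every horizon, and [best] would then bound
    [sup A] by [sup A - d]. *)
Lemma no_uniform_gain (q' : strategy R) T0 T1 (d : R) : is_strategy n q' -> 0 < d ->
  (forall T, (T1 <= T)%N -> state_cost w q q' T n 0 + d <= V (T + T0)%N n 0) -> False.
Proof.
move=> q'S d0 gap; pose A := range (fun T => V T n 0).
have supA T : V T n 0 <= sup A.
  apply: ub_le_sup; last by exists T.
  by exists (ent n 0) => _ [T' _ <-]; exact: init_cost_le.
have : sup A <= sup A - d.
  apply: ge_sup; first by exists (V 0 n 0); exists 0%N.
  move=> _ [T _ <-]; apply: (best q'S) => {}T.
  (* Horizons below [T1] are covered by monotonicity, on passing to [maxn T T1]. *)
  rewrite lerBrDr; apply: le_trans (supA (maxn T T1 + T0)%N).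
  apply: le_trans (gap _ (leq_maxr _ _)); rewrite lerD2r.
  by apply: (state_cost_homo w0 qS q'S) => //; rewrite ?addn0 ?leq_maxl.
by lra.
Qed.

(* Otherwise entering at (m0, k0) and following [q] elsewhere is profitable: the
   cost of this deviation over T steps is at most that of [q] over T + T0 steps,
   with a gap that propagates backwards along a path from (n, 0) to (m0, k0). *)
Lemma reach_cost_le m0 k0 T0 : reach m0 k0 -> V T0 m0 k0 <= ent m0 k0.
Proof.
move=> r0; have [m00 mk0] := reach_valid r0.
rewrite leNgt; apply/negP => gt0.
pose q' m k := if (m == m0) && (k == k0) then 1 else q m k.
have q'S : is_strategy n q'.
  by move=> m k ? ?; rewrite /q'; case: ifP => _; [rewrite ler01 lexx | exact: qS].
pose D T m k := state_cost w q q' T m k.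
have D0 T : D T m0 k0 <= ent m0 k0.
  have q01 := qS m00 mk0; case: T => [|T] /=.
    by apply: le_trans (entry_cost_le w0 0 q01); exact: entry_cost_ge0.
  by rewrite /D /= /q' !eqxx mul1r subrr mul0r addr0 entry_cost_le.
have V0 T : V T0 m0 k0 <= V (T + T0)%N m0 k0.
  by apply: (state_cost_homo w0 qS qS) => //; rewrite leq_addl.
(* Where [q'] agrees with [q], a gap d after outcome b persists, multiplied by the probabilities of
   staying and of b. *)
have step T m k (b : nat) (d : R) : (0 < m)%N -> (m + k <= n)%N ->
    (forall b, (b <= m.-1)%N ->
       D T (m - b)%N (k + b).-1%N <= V (T + T0)%N (m - b)%N (k + b).-1%N) ->
    (b <= m.-1)%N ->
    D T (m - b)%N (k + b).-1%N + d <= V (T + T0)%N (m - b)%N (k + b).-1%N ->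
    (m == m0) && (k == k0) = false ->
    D T.+1 m k + (1 - q m k) * (binomial_pmf m.-1 (q m k) b * d) <= V (T.+1 + T0)%N m k.
  move=> ? mkn IH bm gap ne; have q01 : 0 <= q m k <= 1 by exact: qS.
  have /andP[q0 q1] := q01.
  rewrite addSn /D /V /= {1 2}/q' ne -addrA -mulrDr.
  apply: lerD; apply: ler_wpM2l; rewrite ?subr_ge0 //.
    by apply: entry_cost_homo => //; lia.
  rewrite -addrA lerD2l.
  exact: (@bmean_gap R m.-1 _ (fun b => D T (m - b)%N (k + b).-1%N)
    (fun b => V (T + T0)%N (m - b)%N (k + b).-1%N)).
have DV T m k : (0 < m)%N -> (m + k <= n)%N -> D T m k <= V (T + T0)%N m k.
  elim: T m k => [|T IH] m k m_gt0 mkn; first exact: (state_cost_ge0 w0 qS qS).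
  case: (boolP ((m == m0) && (k == k0))) => [/andP[/eqP-> /eqP->]|/negbTE ne].
    exact: le_trans (D0 _) (le_trans (ltW gt0) (V0 _)).
  have IH' b : (b <= m.-1)%N ->
      D T (m - b)%N (k + b).-1%N <= V (T + T0)%N (m - b)%N (k + b).-1%N.
    by move=> bm; apply: IH; lia.
  have := @step T m k 0%N 0 m_gt0 mkn IH' (leq0n _).
  by rewrite !mulr0 !addr0 => h; exact: (h (IH' _ (leq0n _)) ne).
pose gap m k := exists2 d : R, 0 < d &
  exists T1, forall T, (T1 <= T)%N -> D T m k + d <= V (T + T0)%N m k.
have gap0 : gap m0 k0.
  exists (V T0 m0 k0 - ent m0 k0); first by rewrite subr_gt0.
  by exists 0%N => T _; move: (D0 T) (V0 T); lra.
have gap_init m k : reach m k -> gap m k -> gap n 0.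
  elim=> // {}m {}k b rmk IH bm q1 pb [d d0 [T1 gapT]]; apply: IH.
  have [m_gt0 mkn] := reach_valid rmk.
  (* If the path returns to (m0, k0), where [step] does not apply, the gap is given by [gap0]. *)
  case: (boolP ((m == m0) && (k == k0))) => [/andP[/eqP-> /eqP->] //|/negbTE ne].
  exists ((1 - q m k) * (binomial_pmf m.-1 (q m k) b * d)).
    by rewrite !mulr_gt0 ?subr_gt0.
  exists T1.+1 => -[//|T] TT; apply: step => //; last exact: gapT.
  by move=> b' bm'; apply: DV; lia.
have [d d0 [T1 gapT]] := gap_init _ _ r0 gap0.
exact: (no_uniform_gain q'S d0 gapT).
Qed.

(** The n additional steps keep the horizon from cutting the entry cost. A step lowers m - 1 + k by
    at most one, which the unit cost of staying makes up for. *)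
Lemma reach_cost_ge T m k : reach m k ->
  (minn T (m.-1 + k))%:R <= V (T + n) m k.
Proof.
elim: T m k => [|T IH] m k rmk; have [m_gt0 mkn] := reach_valid rmk.
  by rewrite min0n; exact: (state_cost_ge0 w0 qS qS).
have q01 := qS m_gt0 mkn; have /andP[q0 q1] := q01.
have := reach_cost_le (T.+1 + n) rmk; rewrite /V addSn /= entry_costE; last by lia.
rewrite -/(ent m k); set S := 1 + bmean _ _ _; move=> Sent.
have [q1E|q1N] := eqVneq (q m k) 1.
  rewrite q1E subrr mul0r mul1r addr0 /ent /full_entry_cost q1E mulr1.
  apply: (@le_trans _ _ (m.-1%:R + k%:R)); first by rewrite -natrD ler_nat geq_minr.
  have : 0 <= m.-1%:R :> R by []. have : 0 <= k%:R :> R by [].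
  by move: w2; nra.
have {}q1 : q m k < 1 by rewrite lt_neqAle q1N.
have SM : (minn T.+1 (m.-1 + k))%:R <= S.
  rewrite -lerBlDl -[leLHS](bmean_cst m.-1 (q m k)).
  apply: bmean_supp_le => // b bm pb.
  apply: le_trans (IH _ _ (reach_step rmk bm q1 pb)).
  by rewrite lerBlDl nat1r ler_nat; lia.
(* For q < 1, [Sent] forces S <= ent, so their weighted average is at least S. *)
by nra.
Qed.

Lemma empty_queue_entry m : (1 < m)%N -> reach m 0 -> 2 / w <= q m 0.
Proof.
move=> m1 rm; have := le_trans (reach_cost_ge m.-1 rm) (reach_cost_le _ rm).
rewrite addn0 minnn /ent /full_entry_cost add0r.
have : 0 < m.-1%:R :> R by rewrite ltr0n; lia.
move: m.-1%:R (q m 0) => N x N0 h.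
have w_gt0 : 0 < w by move: w2; lra.
rewrite ler_pdivrMr //.
rewrite -(ler_pM2l N0); move: h; nra.
Qed.

(** Alone and facing an empty queue, the agent is processed at once and for free. *)
Definition wait : strategy R := fun m k => ((m == 1%N) && (k == 0%N))%:R.

Lemma waitS : is_strategy n wait.
Proof. by move=> m k _ _; rewrite /wait ler0n lern1 leq_b1. Qed.

(** At an empty queue with m > 1, [a] bounds the probability that a given opponent stays out. With j
    opponents left the expected number of idle steps is at most a^j / (1 - a^j) <= G a^j, where G =
    1 / (1 - a); [delay m] adds this up over j < m. *)
Let a : R := 1 - 2 / w.
Let G : R := w / 2.
Let delay m : R := G * \sum_(1 <= j < m) a ^+ j.

Let w_gt0 : 0 < w. Proof. by move: w2; lra. Qed.

Let a01 : 0 <= a <= 1.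
Proof.
rewrite /a subr_ge0 ler_pdivrMr // mul1r (ltW w2) /= lerBlDl lerDr.
by rewrite divr_ge0.
Qed.

Let delayS m : (0 < m)%N -> delay m.+1 = delay m + G * a ^+ m.
Proof. by move=> m0; rewrite /delay big_nat_recr //= mulrDr. Qed.

Let delay_homo m m' : (m <= m')%N -> delay m <= delay m'.
Proof.
have /andP[a0 _] := a01; have G0 : 0 <= G by rewrite divr_ge0.
elim: m' => [|m' IH]; first by rewrite leqn0 => /eqP ->.
rewrite leq_eqVlt ltnS => /predU1P[->//|/IH h]; apply: le_trans h _.
case: m' {IH} => [|m']; first by rewrite /delay !big_geq.
by rewrite (delayS (ltn0Sn m')) lerDl mulr_ge0 // exprn_ge0.
Qed.

Let Ga : G * (1 - a) = 1.
Proof. by rewrite /G /a opprB addrC subrK mulrA divfK ?divff // gt_eqF. Qed.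

(** The geometric series is at most a / (1 - a) = G a <= G. *)
Let delay_le m : delay m <= G ^+ 2.
Proof.
have /andP[a0 a1] := a01; have G0 : 0 <= G by rewrite divr_ge0.
rewrite /delay expr2; apply: ler_wpM2l => //.
case: m => [|m]; first by rewrite big_geq.
have -> : \sum_(1 <= j < m.+1) a ^+ j = G * a - G * a ^+ m.+1.
  elim: m => [|m IH]; first by rewrite big_geq // expr1 subrr.
  rewrite big_nat_recr //= IH [a ^+ m.+2]exprS.
  by move: Ga; move: (a ^+ m.+1) => y h; rewrite -[X in _ + X]mul1r -h; ring.
have := mulr_ge0 G0 (exprn_ge0 m.+1 a0).
have : G * a <= G by rewrite -[leRHS]mulr1 ler_wpM2l.
by lra.
Qed.

(* [delay m] pays for the idle steps. The alternative [m = 1] covers the states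
   that waiting reaches when the equilibrium makes everybody enter at once. *)
Lemma wait_cost_le T m k : reach m k \/ m = 1%N -> (0 < m)%N -> (m + k <= n)%N ->
  state_cost w q wait T m k <= m.-1%:R + k%:R + delay m.
Proof.
have /andP[a0 a1] := a01; have G0 : 0 <= G by rewrite divr_ge0.
have delay0 m' : 0 <= delay m'.
  by rewrite /delay mulr_ge0 // sumr_ge0 // => j _; rewrite exprn_ge0.
elim: T m k => [|T IH] m k; first by move=> *; rewrite /= !addr_ge0.
move=> rmk m_gt0 mkn; have q01 := qS m_gt0 mkn; have /andP[q0 q1] := q01.
have IH' b : (b <= m.-1)%N -> 0 < binomial_pmf m.-1 (q m k) b ->
    state_cost w q wait T (m - b)%N (k + b).-1%N
    <= (m - b).-1%:R + (k + b).-1%:R + delay (m - b)%N.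
  move=> bm pb; apply: IH; last 2 first.
    - by move: m_gt0 bm; clear; lia.
    - by move: m_gt0 mkn bm; clear; lia.
  case: rmk => [rmk|m1]; last by right; rewrite m1 in bm *; move: bm; clear; lia.
  move: q1; rewrite le_eqVlt => /predU1P[q1|q1]; last by left; exact: reach_step.
  by right; move: pb; rewrite q1 => /(binomial_pmf1_gt0 bm) ->; move: m_gt0; clear; lia.
rewrite /= /wait; case: (boolP (_ && _)) => [/andP[/eqP m1 /eqP k0]|mk1] /=.
  by rewrite mulr1n subrr mul0r addr0 mul1r m1 k0 entry_costE //
    /full_entry_cost !mul0r addr0 mulr0 !add0r.
rewrite mulr0n mul0r add0r subr0 mul1r.
case: k mkn IH' q01 q0 q1 rmk mk1 => [|k] mkn IH' q01 q0 q1 rmk mk1.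
  have m1 : (1 < m)%N by move: mk1 m_gt0; rewrite andbT; clear; lia.
  have {}rmk : reach m 0 by case: rmk => // m1'; rewrite m1' in m1.
  pose x := a ^+ m.-1.
  have qa := empty_queue_entry m1 rmk.
  have p0 : (1 - q m 0%N) ^+ m.-1 <= x.
    apply: lerXn2r; rewrite ?nnegrE // ?subr_ge0 // /a.
    by rewrite lerD2l lerN2.
  have m'0 : (0 < m.-1)%N by move: m1; clear; lia.
  have xa : x <= a.
    by rewrite /x -(prednK m'0) exprS; exact: ler_piMr a0 (exprn_ile1 _ a0 a1).
  have x0 : 0 <= x by exact: exprn_ge0.
  have dm : delay m = delay m.-1 + G * x.
    by rewrite -[in LHS](prednK m_gt0) (delayS m'0).
  (* When somebody enters, m - 1 + k drops by one and the delay by at least G x; [y] is what an idle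
     step fails to save. *)
  rewrite addr0 dm; set y := 1 + G * x.
  have fb b : (b <= m.-1)%N -> 0 < binomial_pmf m.-1 (q m 0%N) b ->
      state_cost w q wait T (m - b)%N (0 + b).-1%N
      <= (m.-1%:R + delay m - y) + y * (b == 0%N)%:R.
    move=> bm pb; apply: le_trans (IH' b bm pb) _.
    case: b bm pb => [|b] bm pb /=; first by rewrite subn0 addr0 mulr1 subrK.
    rewrite mulr0 addr0 -natrD dm /y.
    have -> : ((m - b.+1).-1 + b = m.-1.-1)%N by move: bm; clear; lia.
    have -> : m.-1%:R = m.-1.-1%:R + 1 :> R by rewrite natr1 prednK.
    have : delay (m - b.+1)%N <= delay m.-1 by apply: delay_homo; move: bm; clear; lia.
    by lra.
  have := bmean_supp_le q01 fb; rewrite bmeanD bmean_cst bmeanZ bmean_at0 dm.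
  move: ((1 - q m 0%N) ^+ m.-1) p0 => z p0.
  rewrite /y; set B := bmean _ _ _ => hB.
  (* Equivalent to z <= G x (1 - z), which follows from z <= x <= a and G (1 - a) = 1. *)
  have : z * (1 + G * x) <= G * x.
    have : G * x * (1 - z) >= G * x * (1 - a).
      by apply: ler_wpM2l; [exact: mulr_ge0|lra].
    rewrite mulrAC Ga mul1r; lra.
  by move: hB; lra.
(* A nonempty queue processes an agent, so m - 1 + k drops by exactly one, whatever b is. *)
suff : bmean m.-1 (q m k.+1) (fun b => state_cost w q wait T (m - b)%N (k.+1 + b).-1%N)
       <= m.-1%:R + k%:R + delay m by rewrite -natr1; lra.
rewrite -[leRHS](bmean_cst m.-1 (q m k.+1)).
apply: bmean_supp_le => // b bm pb; apply: le_trans (IH' b bm pb) _.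
apply: lerD; last by apply: delay_homo; exact: leq_subr.
by rewrite -!natrD ler_nat; move: m_gt0 bm; clear; lia.
Qed.

Lemma cost_bounds :
  (forall T, V T n 0 <= n.-1%:R + (w / 2) ^+ 2) /\
  (forall T, (n + n <= T)%N -> n.-1%:R <= V T n 0).
Proof.
split=> [T|T nT].
  apply: (best waitS) => {}T.
  apply: le_trans (wait_cost_le _ (or_introl reach_init) _ _) _ => //.
    by rewrite addn0.
  by rewrite addr0 lerD2l; exact: delay_le.
apply: le_trans (_ : V (n + n) n 0 <= _); last first.
  by apply: (state_cost_homo w0 qS qS); rewrite ?addn0.
have := reach_cost_ge n reach_init; rewrite addn0 (minn_idPr _) //; lia.
Qed.

End equilibrium.

(** * From finite horizons back to the game *)

Section game.
Context {R : realType} (w : R) (w0 : 0 <= w) (n : nat).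
Implicit Types (q : strategy R) (i : 'I_n).

Lemma deviate_symmetric q i : deviate (symmetric_profile q) i q = symmetric_profile q.
Proof. by apply/funext => j; rewrite /deviate; case: ifP. Qed.

(** Finite-horizon costs are nondecreasing, so their limit is their supremum. *)
Lemma agent_costE q q' i : is_strategy n q -> is_strategy n q' ->
  agent_cost w (deviate (symmetric_profile q) i q') i
  = ereal_sup (range (fun T => (state_cost w q q' T n 0)%:E)).
Proof.
move=> qS q'S; rewrite /agent_cost.
have -> : (fun T => (horizon_cost w (deviate (symmetric_profile q) i q') T (init n) i)%:E)
          = (fun T => (state_cost w q q' T n 0)%:E).
  by apply/funext => T; rewrite horizon_costE ?inE //= cardsT card_ord.
apply/cvg_lim => //; apply: ereal_nondecreasing_cvgn => T T' TT; rewrite lee_fin.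
apply: (state_cost_homo w0 qS q'S) => //; rewrite ?addn0 //.
exact: leq_ltn_trans (ltn_ord i).
Qed.

Lemma agent_cost_le q q' i (M : R) : is_strategy n q -> is_strategy n q' ->
  (agent_cost w (deviate (symmetric_profile q) i q') i <= M%:E)%E
  <-> forall T, state_cost w q q' T n 0 <= M.
Proof.
move=> qS q'S; rewrite agent_costE //; split=> [h T|h].
  by rewrite -lee_fin; apply: le_trans h; apply: ereal_sup_ubound; exists T.
by apply: ge_ereal_sup => _ [T _ <-]; rewrite lee_fin.
Qed.

Lemma equilibrium_best q : (0 < n)%N -> symmetric_equilibrium n w q ->
  forall (q' : strategy R) (M : R), is_strategy n q' ->
  (forall T, state_cost w q q' T n 0 <= M) ->
  forall T, state_cost w q q T n 0 <= M.
Proof.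
move=> n0 [qS eq] q' M q'S h; pose i := Ordinal n0.
apply/(agent_cost_le i M qS qS); rewrite deviate_symmetric.
by apply: le_trans (eq i q' q'S) _; apply/agent_cost_le.
Qed.

End game.

(** * The cost ratio and its limit *)

Lemma equilibrium_agent_cost (R : realType) (w : R) (n : nat) (q : strategy R)
    (i : 'I_n) : 2 < w -> symmetric_equilibrium n w q ->
  (n.-1%:R%:E <= agent_cost w (symmetric_profile q) i
   <= (n.-1%:R + (w / 2) ^+ 2)%:E)%E.
Proof.
move=> w2 eq; have w0 : 0 <= w by apply: le_trans (ltW w2).
have n0 : (0 < n)%N by exact: leq_ltn_trans (ltn_ord i).
have qS := eq.1.
have [ub lb] := cost_bounds w2 n0 qS (equilibrium_best w0 n0 eq).
rewrite -(deviate_symmetric q i); apply/andP; split; last exact/agent_cost_le.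
rewrite agent_costE //; apply: le_trans (_ : ((state_cost w q q (n + n) n 0)%:E <= _)%E).
  by rewrite lee_fin lb.
by apply: ereal_sup_ubound; exists (n + n)%N.
Qed.

(** The ratio equals 2 c / (n - 1), where c is the cost of one agent. *)
Lemma equilibrium_ratio (R : realType) (w : R) (n : nat) (q : strategy R) :
  2 < w -> (2 <= n)%N -> symmetric_equilibrium n w q ->
  (2%:E <= cost_ratio n w q <= (2 + 2 * (w / 2) ^+ 2 / n.-1%:R)%:E)%E.
Proof.
move=> w2 n2 eq; have n0 : (0 < n)%N by exact: ltnW.
have := equilibrium_agent_cost (Ordinal n0) w2 eq.
rewrite /cost_ratio (social_costE _ _ (Ordinal n0)).
case: (agent_cost _ _ _) => [c| |].
- rewrite !lee_fin => /andP[lb ub].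
  have nE : n%:R = n.-1%:R + 1 :> R by rewrite natr1 prednK.
  have m0 : 0 < n.-1%:R :> R by rewrite ltr0n -ltnS prednK.
  have nm0 : n.-1%:R + 1 != 0 :> R by rewrite natr1 pnatr_eq0.
  have opt0 : opt_social_cost R n != 0.
    by rewrite /opt_social_cost nE addrK !mulf_neq0 ?invr_neq0 // gt_eqF.
  rewrite inver (negbTE opt0) -!EFinM !lee_fin /opt_social_cost nE addrK.
  have -> : (n.-1%:R + 1) * c * ((n.-1%:R + 1) * n.-1%:R / 2)^-1 = 2 * c / n.-1%:R.
    by field; rewrite nm0 gt_eqF.
  rewrite ler_pdivlMr // ler_pM2l // lb /=.
  have -> : 2 + 2 * (w / 2) ^+ 2 / n.-1%:R = 2 * (n.-1%:R + (w / 2) ^+ 2) / n.-1%:R.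
    by field; rewrite gt_eqF.
  by rewrite ler_pM2r ?invr_gt0 // ler_pM2l.
- by rewrite leye_eq andbF.
- by rewrite leeNy_eq.
Qed.

Theorem theorem1p1 (R : realType) (w : R) (hw : 2 < w) :
  (forall eps : R, 0 < eps ->
     exists n0 : nat, forall n : nat, (2 <= n)%N -> (n0 < n)%N ->
       forall S : strategy R, symmetric_equilibrium n w S ->
         (2%:E <= cost_ratio n w S)%E /\
         (cost_ratio n w S <= (2 + eps)%:E)%E)
  /\
  (forall S : nat -> strategy R,
     (forall n : nat, (2 <= n)%N -> symmetric_equilibrium n w (S n)) ->
     cost_ratio n w (S n) @[n --> \oo] --> 2%:E).
Proof.
have bound (eps : R) : 0 < eps ->
     exists n0 : nat, forall n : nat, (2 <= n)%N -> (n0 < n)%N ->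
       forall S : strategy R, symmetric_equilibrium n w S ->
         (2%:E <= cost_ratio n w S)%E /\
         (cost_ratio n w S <= (2 + eps)%:E)%E.
  (* The witness exceeds K / eps and is at most n - 1 once n is larger than it, so K / (n - 1) <=
     eps. *)
  move=> eps0; pose K := 2 * (w / 2) ^+ 2; exists (Num.truncn (K / eps)).+1.
  move=> n n2 nK S eq; have /andP[lb ub] := equilibrium_ratio hw n2 eq.
  split=> //; apply: le_trans ub _; rewrite lee_fin lerD2l.
  have m0 : 0 < n.-1%:R :> R by rewrite ltr0n -ltnS prednK // ltnW.
  rewrite -/K ler_pdivrMr // [eps * _]mulrC -ler_pdivrMr //.
  apply/ltW/(lt_le_trans (truncnS_gt (K / eps))).
  by rewrite ler_nat -ltnS prednK // ltnW.
split=> // S eqS; have near_bound (eps : R) : 0 < eps -> \forall n \near \oo,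
    (2%:E <= cost_ratio n w (S n) <= (2 + eps)%:E)%E.
  move=> /bound[n0 h]; near=> n.
  have n2 : (2 <= n)%N by near: n; exact: nbhs_infty_ge.
  have [|lb ub] := h n n2 _ (S n) (eqS n n2); last by rewrite lb ub.
  by near: n; exact: nbhs_infty_gt.
apply/fine_cvgP; split.
  (* Any fixed [eps], here 1, shows that the ratio is eventually finite. *)
  near=> n; have : (2%:E <= cost_ratio n w (S n) <= (2 + 1)%:E)%E.
    by near: n; exact: near_bound.
  by case: cost_ratio => [c| |]; rewrite ?leye_eq ?leeNy_eq ?andbF.
apply/cvgrPdist_le => eps eps0; near=> n => /=.
have : (2%:E <= cost_ratio n w (S n) <= (2 + eps)%:E)%E.
  by near: n; exact: near_bound.
case: cost_ratio => [c| |]; rewrite ?leye_eq ?leeNy_eq ?andbF //= !lee_fin.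
by move=> /andP[lb ub]; rewrite distrC ger0_norm ?subr_ge0 // lerBlDl.
Unshelve. all: by end_near.
Qed.
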